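(* Let $X$ be a (real) ordered vector space with positive cone $X_+$. The following are equivalent: (1) $X$ is Archimedean; (2) $X_+$ is relatively uniformly closed; (3) $X_+$ is $\mathrm{fd}$-closed.
   Context: $X$ is Archimedean if, whenever $x\in X$ and $y\in X_+$ satisfy $nx\le y$ for all $n\in\mathbb N$, one has $x\le 0$. A net $(x_\alpha)$ in $X$ converges relatively uniformly to $x$ if there exists $e\in X_+$ (a regulator) such that for every $n\in\mathbb N$ there is $\alpha_0$ with $-\frac1n e\le x_\alpha-x\le\frac1n e$ for all $\alpha\ge\alpha_0$. Finite-dimensional ($\mathrm{fd}$) convergence: $x_\alpha\to x$ if a tail of the net $(x_\alpha-x)$ is contained in a finite-dimensional subspace of $X$ and converges to zero there in the usual (Euclidean) sense. A set is closed with respect to a convergence if it contains every limit of each convergent net consisting of its elements. No Archimedean assumption is made in advance. *)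

(* Defs.v *)
From HB Require Import structures.
From mathcomp Require Import all_boot all_order all_algebra.
From mathcomp Require Import all_classical all_reals all_analysis.

Set Implicit Arguments.
Unset Strict Implicit.
Unset Printing Implicit Defensive.

Import Order.TTheory GRing.Theory Num.Theory.
Import numFieldNormedType.Exports.
Local Open Scope classical_set_scope.
Local Open Scope ring_scope.

(* The cone need not be generating, and no Archimedean axiom is imposed. *)
HB.mixin Record Lmodule_hasCompatibleOrder (R : numDomainType) V
    of Num.POrderedZmodule V & GRing.Lmodule R V := {
  ordvect_leD2r : forall z x y : V, x <= y -> x + z <= y + z;
  ordvect_scale_ge0 : forall (a : R) (x : V), 0 <= a -> 0 <= x -> 0 <= a *: x
}.

#[short(type="orderedVectType")]
HB.structure Definition OrderedVect (R : numDomainType) :=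
  { V of Num.POrderedZmodule V & GRing.Lmodule R V
       & Lmodule_hasCompatibleOrder R V }.

Definition pos_cone (R : realType) (X : orderedVectType R) : set X :=
  [set x | 0 <= x].
Arguments pos_cone {R} X.

Definition archimedean_order (R : realType) (X : orderedVectType R) : Prop :=
  forall x y : X, pos_cone X y ->
    (forall n : nat, (0 < n)%N -> x *+ n <= y) -> x <= 0.

(* Index sets of nets; as usual, antisymmetry is not required. *)
Record directed (A : Type) (le : A -> A -> Prop) : Prop := Directed {
  directed_inhabited : inhabited A;
  directed_refl : forall a, le a a;
  directed_trans : forall a b c, le a b -> le b c -> le a c;
  directed_ub : forall a b, exists c, le a c /\ le b c
}.

(* The filter generated by the tails of the index set. *)
Definition tails (A : Type) (le : A -> A -> Prop) : set_system A :=
  [set S | exists a0, forall a, le a0 a -> S a].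

Definition net_convergence (X : Type) : Type :=
  forall A : Type, (A -> A -> Prop) -> (A -> X) -> X -> Prop.

Definition closed_for (X : Type) (conv : net_convergence X) (S : set X) : Prop :=
  forall (A : Type) (le : A -> A -> Prop) (u : A -> X) (x : X),
    directed le -> (forall a, S (u a)) -> conv A le u x -> S x.

Definition ru_cvg (R : realType) (X : orderedVectType R) : net_convergence X :=
  fun A le u x =>
    exists2 e : X, pos_cone X e &
      forall n : nat, (0 < n)%N ->
        \forall a \near tails le,
          - ((n%:R : R)^-1 *: e) <= u a - x <= (n%:R : R)^-1 *: e.
Arguments ru_cvg {R} X.

Definition lin_indep (R : realType) (X : lmodType R) (k : nat)
    (b : 'I_k -> X) : Prop :=
  forall c : 'I_k -> R, \sum_(i < k) c i *: b i = 0 -> forall i, c i = 0.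

(* The finite-dimensional subspace is given by a basis b; its Euclidean
   topology, which does not depend on the basis, is that of the coordinates. *)
Definition fd_cvg (R : realType) (X : lmodType R) : net_convergence X :=
  fun A le u x =>
    exists (k : nat) (b : 'I_k -> X) (c : A -> 'I_k -> R),
      [/\ lin_indep b,
          \forall a \near tails le, u a - x = \sum_(i < k) c a i *: b i &
          Num.sqrt (\sum_(i < k) c a i ^+ 2) @[a --> tails le] --> (0 : R)].
Arguments fd_cvg {R} X.

(* Main.v *)
Require Import Defs.
From HB Require Import structures.
From mathcomp Require Import all_boot all_order all_algebra.
From mathcomp Require Import all_classical all_reals all_analysis.

(** Both closedness properties imply the Archimedean one by looking at a
    single sequence: if [n x <= y] for all [n] and [y >= 0], then
    [y / (n + 1) - x] lies in the cone and tends to [- x], relatively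
    uniformly with regulator [y] and also inside the affine line [- x + R y];
    hence [- x] is in the cone ([archimedean_of_harmonic]).

    Conversely, [archimedean_ge0] says that in an Archimedean space [x >= 0] as
    soon as [x + e / n >= 0] for some fixed [e >= 0] and all [n].  For a
    relatively uniform limit the regulator serves as [e].

    For a finite-dimensional limit the difficulty is that the cone need not be
    generating, so that fd-convergence does not imply relatively uniform
    convergence and no regulator is given in advance.  One has to be made out of
    the cone itself ([archimedean_preimage_closed]).  Pull the cone back to a
    coordinate space along a linear map [L], and let [M] be a finite family of
    vectors of the pulled back cone [C] spanning the same subspace as [C].  That
    subspace is closed, so it contains every limit [v] of elements [w] of [C],
    and [v - w] has small coordinates on [M].  With [e] the image under [L] of
    the sum of [M] (which, when [M] is a basis, is an interior point of [C]
    relative to its span), this gives [L v >= L w - e / n >= - e / n] for every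
    [n], hence [L v >= 0]. *)

Set Implicit Arguments.
Unset Strict Implicit.
Unset Printing Implicit Defensive.

Import Order.TTheory GRing.Theory Num.Theory.
Import numFieldNormedType.Exports.
Local Open Scope classical_set_scope.
Local Open Scope ring_scope.

Section OrderedVectTheory.
Variables (R : realType) (X : orderedVectType R).
Implicit Types (x y e : X).

Lemma ov_subr_ge0 x y : 0 <= y - x <-> x <= y.
Proof.
split=> [h|h].
  by have := ordvect_leD2r x _ _ h; rewrite add0r subrK.
by have := ordvect_leD2r (- x) _ _ h; rewrite subrr.
Qed.

Lemma ov_addr_ge0 x y : 0 <= x -> 0 <= y -> 0 <= x + y.
Proof.
by move=> x0 y0; apply: le_trans y0 _; have := ordvect_leD2r y _ _ x0; rewrite add0r.
Qed.

Lemma ov_sumr_ge0 (I : finType) (F : I -> X) :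
  (forall i, 0 <= F i) -> 0 <= \sum_i F i.
Proof.
move=> F0; apply: (big_ind (fun x => 0 <= x)) => // x y; exact: ov_addr_ge0.
Qed.

Lemma ov_ler_wpZl e (a b : R) : 0 <= e -> a <= b -> a *: e <= b *: e.
Proof.
move=> e0 ab; apply/ov_subr_ge0; rewrite -scalerBl.
by apply: ordvect_scale_ge0 => //; rewrite subr_ge0.
Qed.

(** Multiplying the assumption by [n] gives [n (- x) <= e], so this is the
    Archimedean axiom for [- x], in the form in which limits produce it. *)
Lemma archimedean_ge0 e x : archimedean_order X -> 0 <= e ->
  (forall n, (0 < n)%N -> 0 <= x + (n%:R : R)^-1 *: e) -> 0 <= x.
Proof.
move=> arch e0 small; rewrite -[x]opprK -sub0r; apply/ov_subr_ge0.
apply: (arch _ e e0) => n n0; apply/ov_subr_ge0.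
have n_neq0 : n%:R != 0 :> R by rewrite pnatr_eq0 -lt0n.
have := ordvect_scale_ge0 _ _ (ler0n R n) (small n n0).
by rewrite scalerDr scalerA divff// scale1r scaler_nat mulNrn opprK addrC.
Qed.

(** The elements [y / (n + 1) - x] form the test sequence that any closedness
    property of the cone has to handle in order to be Archimedean. *)
Lemma archimedean_of_harmonic :
  (forall x y, 0 <= y ->
     (forall n, 0 <= (n.+1%:R : R)^-1 *: y - x) -> 0 <= - x) ->
  archimedean_order X.
Proof.
move=> H x y y0 xy; apply/ov_subr_ge0; rewrite sub0r.
apply: (H x y y0) => n.
have n_neq0 : n.+1%:R != 0 :> R by rewrite pnatr_eq0.
have /ov_subr_ge0 := xy n.+1 isT.
have n_ge0 : 0 <= (n.+1%:R : R)^-1 by rewrite invr_ge0.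
move=> /(ordvect_scale_ge0 _ _ n_ge0).
by rewrite scalerBr -(scaler_nat n.+1 x) scalerA mulVf// scale1r.
Qed.

End OrderedVectTheory.

(** A finite family in [P] of maximal rank spans [P]: a vector of [P] outside
    its span could be appended to it and would increase the rank, which is
    bounded by [n]. *)
Lemma spanning_rows (F : fieldType) (n : nat) (P : set 'rV[F]_n) :
  exists m (M : 'M[F]_(m, n)),
    (forall i, P (row i M)) /\ (forall w, P w -> (w <= M)%MS).
Proof.
pose Q (r : nat) := exists m (M : 'M[F]_(m, n)),
  (forall i, P (row i M)) /\ \rank M = r.
have exQ : exists r, `[< Q r >].
  by exists 0%N; apply/asboolP; exists 0%N, 0; split=> [[]//|]; rewrite mxrank0.
have ubQ r : `[< Q r >] -> (r <= n)%N.
  by move=> /asboolP [m [M [_ <-]]]; exact: rank_leq_col.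
case: (ex_maxnP exQ ubQ) => r /asboolP [m [M [PM rM]]] maxr.
exists m, M; split=> // w Pw.
have [] : Q (\rank (col_mx M w)) /\ (M <= col_mx M w)%MS.
  split; last by rewrite -addsmxE addsmxSl.
  exists (m + 1)%N, (col_mx M w); split=> // i.
  case: (split_ordP i) => j ->.
    by rewrite rowKu.
  by rewrite rowKd row_id.
move=> /asboolP/maxr rank_le sub.
have /eqmxP : (M == col_mx M w)%MS.
  by rewrite -(geq_leqif (mxrank_leqif_eq sub)) rM.
by move=> ->; rewrite -addsmxE addsmxSr.
Qed.

(** Continuity at 0 of a linear map between coordinate spaces.  It is used for
    [cokermx], to see that a row space is closed, and for [pinvmx], to control
    coordinates with respect to a spanning family. *)
Lemma mulmx_small (R : realFieldType) (n p : nat) (B : 'M[R]_(n, p)) (eps : R) :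
  0 < eps -> exists2 eta : R, 0 < eta &
    forall d : 'rV[R]_n, (forall i, `|d 0 i| <= eta) ->
      forall j, `|(d *m B) 0 j| <= eps.
Proof.
move=> eps0; pose C := \sum_i \sum_j `|B i j|.
have C0 : 0 <= C by apply: sumr_ge0 => i _; apply: sumr_ge0.
have C1 : 0 < C + 1 by rewrite ltr_wpDl.
(* C itself vanishes when B = 0, whence the denominator C + 1. *)
exists (eps / (C + 1)); first by rewrite divr_gt0.
move=> d d_le j; rewrite mxE.
have -> : eps = eps / (C + 1) * (C + 1) by rewrite divfK// gt_eqF.
apply: (le_trans (ler_norm_sum _ _ _)).
apply: (@le_trans _ _ (eps / (C + 1) * C)); last first.
  by rewrite ler_wpM2l ?lerDl// divr_ge0 ?ltW.
rewrite mulr_sumr; apply: ler_sum => i _; rewrite normrM.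
apply: ler_pM => //.
by rewrite (bigD1 j)//= lerDl sumr_ge0.
Qed.

(** The pulled back cone [L w >= 0] of the coordinate space is closed.  The
    regulator is the sum of the images of a finite family that spans it.
    Limits are taken in the coordinate space rather than in a subspace of [X],
    so that matrices give both the closedness of spans and the coordinates. *)
Lemma archimedean_preimage_closed (R : realType) (X : orderedVectType R)
    (n : nat) (L : {linear 'rV[R]_n -> X}) (v : 'rV[R]_n) :
  archimedean_order X ->
  (forall eta : R, 0 < eta ->
     exists2 w, 0 <= L w & forall i, `|(v - w) 0 i| <= eta) ->
  0 <= L v.
Proof.
move=> arch adh.
have [m [M [posM spanM]]] := spanning_rows [set w | 0 <= L w].
(* The span of the cone is the kernel of cokermx M, hence closed. *)
have vM : (v <= M)%MS.
  rewrite submxE; apply/eqP/rowP => j; rewrite [RHS]mxE.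
  apply/eqP; rewrite -normr_le0; apply/ler_addgt0Pl => eps eps0; rewrite addr0.
  have [eta eta0 small] := mulmx_small (cokermx M) eps0.
  have [w Lw /small/(_ j)] := adh eta eta0.
  have /eqP wM : w *m cokermx M == 0 by rewrite -submxE spanM.
  by rewrite mulmxBl wM subr0.
apply: (@archimedean_ge0 _ _ (\sum_j L (row j M))) => //.
  exact: ov_sumr_ge0.
move=> p p0.
have ip0 : 0 < (p%:R : R)^-1 by rewrite invr_gt0 ltr0n.
have [eta eta0 small] := mulmx_small (pinvmx M) ip0.
have [w Lw /small d_le] := adh eta eta0.
(* d gathers coordinates of v - w on the rows of M, each at least - 1 / p. *)
pose d := (v - w) *m pinvmx M.
have vE : v = w + d *m M.
  rewrite mulmxKpV ?(addrC w) ?subrK//.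
  by rewrite addmx_sub// eqmx_opp spanM.
(* L v + e / p = L w + \sum_j (d_j + 1 / p) L (row j M). *)
rewrite vE linearD mulmx_sum_row linear_sum -addrA.
apply: ov_addr_ge0 => //.
rewrite scaler_sumr -big_split; apply: ov_sumr_ge0 => j /=.
rewrite linearZ -scalerDl; apply: ordvect_scale_ge0; last exact: posM.
by rewrite -lerBlDr sub0r; have /ler_normlP[+ _] := d_le j; rewrite lerNl.
Qed.

Definition lincomb (R : realType) (X : lmodType R) (n : nat) (g : 'I_n -> X)
  (w : 'rV[R]_n) : X := \sum_i w 0 i *: g i.

Lemma lincomb_is_linear (R : realType) (X : lmodType R) (n : nat)
  (g : 'I_n -> X) : linear (lincomb g).
Proof.
move=> a u w; rewrite /lincomb scaler_sumr -big_split; apply: eq_bigr => i _ /=.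
by rewrite !mxE scalerDl scalerA.
Qed.

HB.instance Definition _ (R : realType) (X : lmodType R) (n : nat)
  (g : 'I_n -> X) := GRing.isLinear.Build R 'rV[R]_n X *:%R (lincomb g)
    (lincomb_is_linear g).

Lemma tails_proper (A : Type) (le : A -> A -> Prop) :
  directed le -> ProperFilter (tails le).
Proof.
move=> [[a] lexx le_trans le_ub]; apply: Build_ProperFilter_ex.
  by move=> S [a0 S0]; exists a0; exact: S0.
split.
- by exists a.
- move=> P Q [p Pp] [q Qq]; have [r [pr qr]] := le_ub p q.
  by exists r => b rb; split; [apply: Pp|apply: Qq]; apply: le_trans rb.
- by move=> P Q PQ [p Pp]; exists p => b /Pp/PQ.
Qed.

Lemma directed_leq : directed (fun m n : nat => (m <= n)%N).
Proof.
split=> [|n|m n p|m n]; [exact: inhabits 0%N|exact: leqnn|exact: leq_trans|].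
by exists (maxn m n); rewrite leq_maxl leq_maxr.
Qed.

(** In homogeneous coordinates the fd-convergent net becomes a net in the pulled
    back cone that converges coordinatewise; the Euclidean norm dominates each
    coordinate. *)
Lemma archimedean_fd_closed (R : realType) (X : orderedVectType R) :
  archimedean_order X -> closed_for (fd_cvg X) (pos_cone X).
Proof.
move=> arch A le u x dir u0 [k [b [c [_ uE c0]]]]; rewrite /pos_cone /=.
have ? := tails_proper dir.
(* The limit x may lie outside the span of b, so it gets a coordinate of its
   own: u a is the image of (1, c a), and x the image of (1, 0). *)
pose g (i : 'I_(1 + k)) := if fintype.split i is inr j then b j else x.
pose v : 'rV[R]_(1 + k) := row_mx 1%:M 0.
have gE (t : R) (w : 'rV[R]_k) :
    lincomb g (row_mx t%:M w) = t *: x + \sum_j w 0 j *: b j.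
  rewrite /lincomb big_split_ord big_ord1 /= row_mxEl mxE eqxx mulr1n /g.
  rewrite (unsplitK (inl _)); congr (_ + _); apply: eq_bigr => j _.
  by rewrite row_mxEr (unsplitK (inr _)).
have -> : x = lincomb g v.
  rewrite gE scale1r big1 ?addr0// => j _.
  by rewrite mxE scale0r.
apply: archimedean_preimage_closed => // eta eta0.
move/cvgr0Pnorm_le: c0 => /(_ eta eta0) c_le.
have [a [ua ca]] := @filter_ex _ (tails le) _ _ (filterI uE c_le).
exists (row_mx 1%:M (\row_j c a j)).
  rewrite /= gE scale1r; under eq_bigr do rewrite mxE.
  by rewrite -ua addrC subrK; exact: u0.
rewrite opp_row_mx add_row_mx subrr sub0r => i.
case: (split_ordP i) => j ->.
  by rewrite row_mxEl mxE normr0 ltW.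
rewrite row_mxEr !mxE normrN; apply: le_trans ca.
rewrite [leRHS]ger0_norm ?sqrtr_ge0// -sqrtr_sqr ler_wsqrtr//.
by rewrite (bigD1 j)//= lerDl sumr_ge0// => l _; rewrite sqr_ge0.
Qed.

Lemma archimedean_ru_closed (R : realType) (X : orderedVectType R) :
  archimedean_order X -> closed_for (ru_cvg X) (pos_cone X).
Proof.
move=> arch A le u x dir u0 [e e0 ux].
have ? := tails_proper dir.
apply: (archimedean_ge0 arch e0) => n n0.
have /filter_ex[a /andP[_ /ov_subr_ge0 xe]] := ux n n0.
have := ov_addr_ge0 (u0 a) xe.
by rewrite opprB addrC addrA subrK addrC.
Qed.

Lemma ru_closed_archimedean (R : realType) (X : orderedVectType R) :
  closed_for (ru_cvg X) (pos_cone X) -> archimedean_order X.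
Proof.
move=> cl; apply: archimedean_of_harmonic => x y y0 xy.
apply: (cl _ _ _ _ directed_leq xy); exists y => // n n0.
exists n => a na; rewrite opprK subrK -scaleNr.
have n_gt0 : 0 < n%:R :> R by rewrite ltr0n.
rewrite !ov_ler_wpZl//.
  by rewrite lef_pV2 ?posrE// ler_nat ltnW.
by rewrite (@le_trans _ _ 0)// ?oppr_le0 invr_ge0.
Qed.

Lemma fd_closed_archimedean (R : realType) (X : orderedVectType R) :
  closed_for (fd_cvg X) (pos_cone X) -> archimedean_order X.
Proof.
move=> cl; apply: archimedean_of_harmonic => x y y0 xy.
(* If y = 0 it spans no line, but then x <= 0 is already an instance of the
   hypothesis. *)
have [yE|y_neq0] := eqVneq y 0.
  by have := xy 0%N; rewrite yE scaler0 sub0r.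
apply: (cl _ _ _ _ directed_leq xy).
exists 1%N, (fun=> y), (fun n _ => n.+1%:R^-1); split.
- move=> c; rewrite big_ord1 => /eqP; rewrite scaler_eq0 (negbTE y_neq0) orbF.
  by move=> /eqP c0 i; rewrite ord1.
- by exists 0%N => a _; rewrite opprK subrK big_ord1.
- under eq_fun do rewrite big_ord1 sqrtr_sqr ger0_norm ?invr_ge0//.
  by move=> S /cvg_harmonic [N _ NS]; exists N => a /NS.
Qed.

Theorem proposition7p13 (R : realType) (X : orderedVectType R) :
  [<-> archimedean_order X;
       closed_for (ru_cvg X) (pos_cone X);
       closed_for (fd_cvg X) (pos_cone X)].
Proof.
tfae.
- exact: archimedean_ru_closed.
- by move=> /ru_closed_archimedean; exact: archimedean_fd_closed.
- exact: fd_closed_archimedean.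
Qed.
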